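(* Let $L$ be a locally finite Lie algebra over a field of characteristic $0$. Suppose that for every finite set $x_1,x_2,\ldots,x_k\in L$ there is a finite-dimensional subalgebra $A$ of $L$ which contains these elements and for which $L(\operatorname{ad}A)^n\subset A$ for some positive integer $n$. Then $L$ is locally solvable if and only if $\operatorname{tr}\big((\operatorname{ad}a)^2\big)=0$ for every $a\in L'$.
   Context: Linear transformations are written on the right; $\operatorname{ad}a$ is the map $x\mapsto[x,a]$ of $L$. $L(\operatorname{ad}A)^n$ is the linear span of all elements $[\ldots[[x,a_1],a_2],\ldots,a_n]$ with $x\in L$, $a_i\in A$. $L'=[L,L]$. A Lie algebra is locally finite if every finite subset is contained in a finite-dimensional subalgebra, and locally solvable if every finite subset is contained in a solvable subalgebra. For a linear transformation $T$ of a vector space $V$, the Fitting null component is $V_{0T}=\{y\in V: yT^m=0\text{ for some positive integer }m\}$; if it has finite codimension in $V$, $\operatorname{tr}T$ is defined as the trace of the transformation induced by $T$ in the finite-dimensional space $V/V_{0T}$. Under the stated hypothesis on $L$, the Fitting null component of $(\operatorname{ad}a)^2$ has finite codimension in $L$ for every $a\in L$, so the trace is defined. *)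

(* Defs.v *)
From HB Require Import structures.
From mathcomp Require Import all_boot all_order all_algebra.
From mathcomp Require Import boolp classical_sets.

Set Implicit Arguments.
Unset Strict Implicit.
Unset Printing Implicit Defensive.

Import GRing.Theory.

Local Open Scope classical_set_scope.
Local Open Scope ring_scope.

HB.mixin Record Lmodule_isLieAlgebra (F : fieldType) L of GRing.Lmodule F L := {
  bracket : L -> L -> L;
  bracket_linear_l : forall (c : F) (x y z : L),
    bracket (c *: x + y) z = c *: bracket x z + bracket y z;
  bracket_linear_r : forall (c : F) (x y z : L),
    bracket z (c *: x + y) = c *: bracket z x + bracket z y;
  bracketxx : forall x : L, bracket x x = 0;
  bracket_jacobi : forall x y z : L,
    bracket (bracket x y) z + bracket (bracket y z) x
      + bracket (bracket z x) y = 0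
}.

#[short(type="lieAlgType")]
HB.structure Definition LieAlgebra (F : fieldType) :=
  {L of Lmodule_isLieAlgebra F L & GRing.Lmodule F L}.

Section LinearSpan.
Context {F : fieldType} {V : lmodType F}.

Definition lspan (S : set V) : set V :=
  [set x | exists (n : nat) (c : 'I_n -> F) (v : 'I_n -> V),
     (forall i, S (v i)) /\ x = \sum_(i < n) c i *: v i].

Definition finite_dimensional (W : set V) : Prop :=
  exists s : seq V, W = lspan [set` s].

Definition fitting_null (T : {linear V -> V}) : set V :=
  [set y | exists2 m : nat, (0 < m)%N & iter m T y = 0].

(* [is_fitting_trace T t] : the Fitting null component of T has finite
   codimension and t is the trace of the transformation induced by T in the
   quotient by it.  The surjection p, whose kernel is the null component,
   identifies the quotient with 'rV_n; M is the matrix (acting on the right) of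
   the induced transformation. *)
Definition is_fitting_trace (T : {linear V -> V}) (t : F) : Prop :=
  exists (n : nat) (p : {linear V -> 'rV[F]_n}) (M : 'M[F]_n),
    [/\ forall u : 'rV[F]_n, exists x : V, p x = u,
        forall x : V, p x = 0 <-> fitting_null T x,
        forall x : V, p (T x) = p x *m M
      & t = \tr M].

Lemma is_fitting_trace_unique (T : {linear V -> V}) (t t' : F) :
  is_fitting_trace T t -> is_fitting_trace T t' -> t = t'.
Proof.
have aux n n' (p : {linear V -> 'rV[F]_n}) (p' : {linear V -> 'rV[F]_n'}) :
    (forall u, exists x, p x = u) ->
    (forall x, p x = 0 -> p' x = 0) ->
    exists P : 'M[F]_(n, n'), forall x, p' x = p x *m P.
  move=> sp kp; have [g gP] := choice sp.
  exists (\matrix_(i < n) p' (g (delta_mx 0 i))) => x.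
  apply/eqP; rewrite -subr_eq0; apply/eqP.
  rewrite mulmx_sum_row.
  under eq_bigr do rewrite rowK -linearZ.
  rewrite -linear_sum -linearB; apply: kp.
  rewrite linearB linear_sum /=.
  under eq_bigr do rewrite linearZ /= gP.
  by rewrite -row_sum_delta subrr.
have inj n (p : {linear V -> 'rV[F]_n}) m (A B : 'M[F]_(n, m)) :
    (forall u, exists x, p x = u) -> (forall x, p x *m A = p x *m B) -> A = B.
  move=> sp AB; apply/row_matrixP => i; rewrite !rowE.
  by have [x <-] := sp (delta_mx 0 i).
move=> [n [p [M [sp kp pT ->]]]] [n' [p' [M' [sp' kp' pT' ->]]]].
have [P PE] : exists P : 'M[F]_(n, n'), forall x, p' x = p x *m P.
  by apply: aux => // x /kp/kp'.
have [Q QE] : exists Q : 'M[F]_(n', n), forall x, p x = p' x *m Q.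
  by apply: aux => // x /kp'/kp.
have PQ : P *m Q = 1%:M.
  by apply: (inj _ p) => // x; rewrite mulmxA -PE -QE mulmx1.
have MP : M *m P = P *m M'.
  by apply: (inj _ p) => // x; rewrite !mulmxA -pT -!PE pT'.
have QP : Q *m P = 1%:M.
  by apply: (inj _ p') => // x; rewrite mulmxA -QE -PE mulmx1.
by rewrite -[M]mulmx1 -PQ mulmxA MP -mulmxA mxtrace_mulC -mulmxA QP mulmx1.
Qed.

End LinearSpan.

Section LieAlgebraTheory.
Context {F : fieldType} {L : lieAlgType F}.

Definition ad (a : L) : L -> L := fun x => bracket x a.

Fact ad_is_linear (a : L) : linear (ad a).
Proof. by move=> c x y; rewrite /ad bracket_linear_l. Qed.

HB.instance Definition _ (a : L) :=
  GRing.isLinear.Build F L L *:%R (ad a) (ad_is_linear a).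

Definition subalgebra (A : set L) : Prop :=
  [/\ A 0,
      forall x y, A x -> A y -> A (x + y),
      forall (c : F) x, A x -> A (c *: x)
    & forall x y, A x -> A y -> A (bracket x y)].

(* [A, B], as a linear span *)
Definition bracket_set (A B : set L) : set L :=
  lspan [set z | exists x y, [/\ A x, B y & z = bracket x y]].

(* L (ad A)^n *)
Definition L_adn (A : set L) (n : nat) : set L :=
  lspan [set z | exists (x : L) (a : n.-tuple L),
           (forall i : 'I_n, A (tnth a i)) /\ z = foldl bracket x a].

Definition solvable_alg (A : set L) : Prop :=
  exists k : nat, iter k (fun B => bracket_set B B) A = [set 0].

End LieAlgebraTheory.

Definition locally_finite (F : fieldType) (L : lieAlgType F) : Prop :=
  forall s : seq L, exists A : set L,
    [/\ subalgebra A, finite_dimensional A & [set` s] `<=` A].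

Definition locally_solvable (F : fieldType) (L : lieAlgType F) : Prop :=
  forall s : seq L, exists A : set L,
    [/\ subalgebra A, solvable_alg A & [set` s] `<=` A].

Definition derived_algebra (F : fieldType) (L : lieAlgType F) : set L :=
  bracket_set [set: L] [set: L].

Arguments derived_algebra {F} L _.

(* Main.v *)
Require Import Defs.
From HB Require Import structures.
From mathcomp Require Import all_boot all_order all_algebra all_field.
From mathcomp Require Import ring.
From mathcomp Require Import boolp classical_sets.

Set Implicit Arguments.
Unset Strict Implicit.
Unset Printing Implicit Defensive.

Import Order.TTheory GRing.Theory Num.Theory.

Local Open Scope classical_set_scope.
Local Open Scope ring_scope.

(** Let [A] be a finite-dimensional subalgebra containing [a], with
    [L (ad A)^n] inside [A].  Some power of [ad a] maps [L] into [A], so [L] is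
    [A] plus the Fitting null component of [(ad a)^2], and the Fitting trace of
    [(ad a)^2] is the ordinary trace of its restriction to [A]
    ([fitting_trace_absorbing]).  Both implications thus concern the matrices
    [M a] of [ad a] on such an [A]; they form a Lie algebra [g] of square
    matrices whose derived series is the image of that of [A]
    ([adjoint_algebra]).

    If [L] is locally solvable, then [A], being spanned by finitely many
    elements, is solvable.  In characteristic 0 the matrices in the derived
    algebra of a solvable [g] are nilpotent ([solvable_derived_nilpotent]), so
    for [a] in the derived algebra of [A] the map [ad a] is nilpotent on [A],
    hence on [L], and its Fitting null component is all of [L].  The nilpotency
    is proved without eigenvectors: when [d] is a sum of commutators of [a_i]
    with [b_i], and the commutators of [d] with the [a_i] lie in an ideal whose
    products of some fixed length vanish, all powers of [d] have trace 0, so [d]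
    is nilpotent ([commutator_nilpotent]); Engel's theorem ([engel]) then shows
    that long products of such [d] vanish, and the argument can be repeated one
    step higher.

    Conversely, if the traces vanish, polarization makes the trace form of
    the derived algebra of [g] vanish, and Cartan's criterion
    ([cartan_criterion]) gives that [g] is solvable; as [g] is the quotient of
    [A] by its center, so is [A].  For Cartan's criterion, a perfect term [H] of
    the derived series has to be 0.  By Engel's theorem it suffices that each
    [x] in [H] is nilpotent.  Extend scalars to a splitting field of the
    characteristic polynomial of [x], take rational numbers [mu_i] satisfying
    every rational linear relation between the eigenvalues [lam_i] of [x], and
    let [y] act by [mu_i] on the generalized eigenspace of [lam_i].  Then [ad y]
    preserves [H], so perfectness and isotropy give [tr (x y) = 0], that is, the
    relation [sum_i m_i mu_i lam_i = 0] with [m_i > 0] the multiplicities.  Hence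
    [sum_i m_i mu_i ^ 2 = 0] and [mu = 0]: only the zero vector is orthogonal to
    the relations, so every vector is a relation and all [lam_i] are 0
    ([split_perfect_isotropic_nilpotent]). *)

(** * Traces of nilpotent and idempotent matrices *)

(** Induction on the size: with a rank factorization [x = c b], the smaller
    matrix [b c] is again nilpotent and has the same trace; the rank drops
    because a nilpotent matrix of positive size is singular. *)
Lemma mxtrace_nilpotent (F : fieldType) n (x : 'M[F]_n) k :
  x ^+ k = 0 -> \tr x = 0.
Proof.
have [m] := ubnP n; elim: m n x k => // m IH n x k lt_nm xk0.
have [n0|n_gt0] := posnP n; first by subst n; rewrite /mxtrace big_ord0.
have lt_rn : (\rank x < n)%N.
  rewrite ltn_neqAle rank_leq_row andbT; apply/negP => free_x.
  have free_xk j : row_free (x ^+ j).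
    elim: j => [|j IHj]; first by rewrite expr0 -row_leq_rank mxrank1.
    rewrite exprS /row_free mxrankMfree //; exact: free_x.
  by have := free_xk k; rewrite xk0 /row_free mxrank0 -[n]prednK.
have Dx := mulmx_base x; move: (col_base x) (row_base x) Dx => c b Dx.
rewrite -Dx mxtrace_mulC.
apply: (IH _ _ k.+1); first exact: leq_trans lt_rn _.
have E j : (b *m c) ^+ j.+1 = b *m x ^+ j *m c.
  elim: j => [|j IHj]; first by rewrite expr1 expr0 mulmx1.
  rewrite exprS IHj (exprS x) -[LHS]/((b *m c) *m _) -[x * _]/(x *m _).
  by rewrite -!mulmxA (mulmxA c) Dx.
by rewrite E xk0 mulmx0 mul0mx.
Qed.

(** In a rank factorization [e = c b] of an idempotent, [b c] is the identity
    matrix of size the rank. *)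
Lemma mxtrace_idempotent (F : fieldType) n (e : 'M[F]_n) :
  e *m e = e -> \tr e = (\rank e)%:R.
Proof.
move=> ee; have De := mulmx_base e.
have /row_fullP[c' c'1] := col_base_full e.
have /row_freeP[b' b'1] := row_base_free e.
move: (col_base e) (row_base e) De c' c'1 b' b'1 => c b De c' c'1 b' b'1.
rewrite -{1}De mxtrace_mulC -[b *m c]mulmx1 -b'1 -[b *m c]mul1mx -{1}c'1.
by rewrite -!mulmxA (mulmxA c b) De (mulmxA c b) De (mulmxA e e) ee -[X in X *m b']De
           -!mulmxA b'1 mulmx1 c'1 mxtrace1.
Qed.

(** The projection [e] onto the Fitting one-component of [x] is a polynomial
    in [x] without constant term, hence has trace 0; but the trace of an
    idempotent is its rank, so [e = 0] in characteristic 0. *)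
Lemma nilpotent_mxtrace (F : fieldType) n (x : 'M[F]_n.+1) :
    [pchar F] =i pred0 -> (forall k, \tr (x ^+ k.+1) = 0) ->
  exists k, x ^+ k = 0.
Proof.
move=> charF trx.
have [m [r nr0 Dp]] := multiplicity_XsubC (char_poly x) 0.
have p0 : char_poly x != 0 by rewrite monic_neq0 ?char_poly_monic.
move: nr0 Dp; rewrite p0 /= subr0 => nr0 Dp.
(* The exponent m.+1 rather than m keeps the polynomial defining e free of a
   constant term even when x is invertible. *)
have /Bezout_eq1_coprimepP[[u v] /= uv1] : coprimep ('X ^+ m.+1) r.
  by rewrite coprimep_expl // coprimep_sym -['X]subr0 coprimep_XsubC.
have trq (q : {poly F}) : \tr (horner_mx x (q * 'X)) = 0.
  rewrite -[q]coefK poly_def mulr_suml !raddf_sum big1 // => i _.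
  by rewrite /= -scalerAl -exprSr linearZ /= rmorphXn /= horner_mx_X mxtraceZ
             trx mulr0.
pose e := horner_mx x (u * 'X ^+ m.+1).
have De : 1 - e = horner_mx x (v * r).
  by rewrite -(rmorph1 (horner_mx x)) -uv1 rmorphD /= addrC addKr.
have ee : e * e = e.
  apply/eqP; rewrite -subr_eq0 -[X in _ - X]mulr1 -mulrBr -opprB mulrN oppr_eq0 De.
  rewrite -rmorphM /=; apply/eqP.
  suff -> : u * 'X ^+ m.+1 * (v * r) = (u * v * 'X) * (r * 'X^m).
    by rewrite -Dp rmorphM /= Cayley_Hamilton mulr0.
  by rewrite exprS; ring.
have tre : \tr e = 0 by rewrite /e exprSr mulrA trq.
have e0 : e = 0.
  apply/eqP; rewrite -mxrank_eq0; move: tre; rewrite mxtrace_idempotent //.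
  by move/eqP; rewrite (pcharf0P _).1.
move: De; rewrite e0 subr0 => De.
exists m; rewrite -[LHS]mul1r De -[X in X ^+ m]horner_mx_X -rmorphXn -rmorphM /=.
by rewrite -mulrA -Dp rmorphM /= Cayley_Hamilton mulr0.
Qed.

(** * Subspaces as predicates *)

Section Subspace.
Variables (F : fieldType) (V : vectType F).

(** Subspaces as predicates, so that spans over sets of an infinite-dimensional
    space and over finite-dimensional matrix spaces share one induction
    principle. *)
Definition linear_pred (W : lmodType F) (P : W -> Prop) :=
  P 0 /\ forall (c : F) x y, P x -> P y -> P (c *: x + y).

Lemma linear_pred_sum (W : lmodType F) (P : W -> Prop) (I : Type) (r : seq I)
    (Q : pred I) (c : I -> F) (v : I -> W) :
  linear_pred P -> (forall i, Q i -> P (v i)) ->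
  P (\sum_(i <- r | Q i) c i *: v i).
Proof.
move=> [P0 PD] Pv; elim/big_rec: _ => // i x Qi Px.
exact: PD (Pv i Qi) Px.
Qed.

Lemma span_ind (P : V -> Prop) (X : seq V) :
  linear_pred P -> (forall x, x \in X -> P x) -> forall x, x \in <<X>>%VS -> P x.
Proof.
move=> linP PX x; rewrite -[X]/(val (in_tuple X)) => /coord_span ->.
apply: linear_pred_sum => // i _.
by apply: PX; rewrite mem_nth.
Qed.

(** Take a subspace of largest dimension among those inside the predicate. *)
Lemma vspace_of_pred (P : V -> Prop) :
  linear_pred P -> exists U : {vspace V}, forall x, x \in U <-> P x.
Proof.
move=> linP.
pose Q n := `[< exists U : {vspace V}, \dim U = n /\ forall x, x \in U -> P x >].
have Q0 : exists n, Q n.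
  exists 0%N; apply/asboolP; exists 0%VS; split; first exact: dimv0.
  by move=> x; rewrite memv0 => /eqP->; case: linP.
have Qb n : Q n -> (n <= \dim {:V})%N.
  by case/asboolP => U [<- _]; apply: dimvS; apply: subvf.
case: (ex_maxnP Q0 Qb) => n /asboolP[U [Un UP]] maxn; exists U => x.
split=> [/UP //|Px]; case: (boolP (x \in U)) => // xU.
suff /maxn : Q n.+1 by rewrite ltnn.
apply/asboolP; exists (U + <[x]>)%VS; split.
  rewrite dimv_disjoint_sum ?Un ?dim_vline.
    by case: eqP xU => [->|_ _]; rewrite ?mem0v ?addn1.
  apply/eqP; rewrite -subv0; apply/subvP => y; rewrite memv_cap memv0.
  case/andP=> yU /vlineP[c Dy]; rewrite Dy scaler_eq0; apply/orP; left.
  apply/negPn/negP => c0; case/negP: xU.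
  by rewrite -[x](scalerK c0) memvZ // -Dy.
move=> y /memv_addP[u /UP Pu [w /vlineP[c ->] ->]]; rewrite addrC.
by case: linP => _; apply.
Qed.

End Subspace.

(** * Commutators of subspaces and Engel's theorem *)

Section Commutator.
Context {F : fieldType} {R : falgType F}.
Implicit Types (a b x : R) (U V W S H I M : {vspace R}).

Definition commr a b := a * b - b * a.

Definition commv U V : {vspace R} :=
  <<[seq commr a b | a <- vbasis U, b <- vbasis V]>>%VS.

Lemma commr_linearl b : linear (commr^~ b).
Proof.
by move=> c x y; rewrite /commr mulrDl mulrDr -scalerAl -scalerAr scalerBr opprD addrACA.
Qed.

Lemma commr_linearr a : linear (commr a).
Proof.
by move=> c x y; rewrite /commr mulrDl mulrDr -scalerAl -scalerAr scalerBr opprD addrACA.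
Qed.

HB.instance Definition _ a :=
  GRing.isLinear.Build F R R *:%R (commr a) (commr_linearr a).

Lemma commrC a b : commr a b = - commr b a.
Proof. by rewrite /commr opprB. Qed.

Lemma commr_derivation a x b :
  commr a (x * b) = commr a x * b + x * commr a b.
Proof. by rewrite /commr mulrBl mulrBr !mulrA addrA subrK. Qed.

Lemma mem_commv U V a b : a \in U -> b \in V -> commr a b \in commv U V.
Proof.
move=> /coord_vbasis-> /coord_vbasis->; rewrite linear_sum.
apply: memv_suml => j _; rewrite linearZ memvZ //= commrC memvN linear_sum.
apply: memv_suml => i _; rewrite linearZ memvZ //= -memvN -commrC memv_span //.
by apply/allpairsP; exists ((vbasis U)`_i, (vbasis V)`_j); rewrite !mem_nth ?size_tuple.
Qed.

Lemma commv_ind (P : R -> Prop) U V :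
    linear_pred P -> {in U & V, forall a b, P (commr a b)} ->
  forall x, x \in commv U V -> P x.
Proof.
move=> linP PUV; apply: span_ind => // x /allpairsP[[a b] [/= aU bV ->]].
by apply: PUV; apply: vbasis_mem.
Qed.

Lemma commvP U V W :
  {in U & V, forall a b, commr a b \in W} -> (commv U V <= W)%VS.
Proof.
move=> UVW; apply/subvP; apply: commv_ind => //.
by split=> [|c x y xW yW]; rewrite ?mem0v // memvD // memvZ.
Qed.

(** Keep bracketing [h] with elements of [S] as long as the result stays outside
    [S]; this stops before step [m], where the result would be 0, and it stops at
    a normalizing element. *)
Lemma ex_normalizing H S m h :
    {in H & H, forall a b, commr a b \in H} -> (S <= H)%VS ->
    h \in H -> h \notin S ->
    (forall s : seq R, size s = m -> all (mem S) s -> foldl commr h s = 0) ->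
  exists z, [/\ z \in H, z \notin S & {in S, forall s, commr z s \in S}].
Proof.
move=> HH /subvP SH; elim: m h => [|m IH] h hH hS kill.
  by have /= h0 := kill [::] erefl erefl; rewrite h0 mem0v in hS.
case: (pselect ({in S, forall s, commr h s \in S})) => [hSS|].
  by exists h.
move=> /existsNP[s /not_implyP[sS /negP hsS]].
apply: (IH (commr h s)) => //; first by apply: HH => //; apply: SH.
by move=> w sz wS; apply: (kill (s :: w)) => /=; rewrite ?sz ?sS.
Qed.

Lemma foldl_commr_linear (w : seq R) :
  exists f : {linear R -> R}, forall h, f h = foldl commr h w.
Proof.
elim: w => [|s w [f fE]]; first by exists idfun.
exists (f \o (-%R \o commr s)) => h /=.
by rewrite fE -commrC.
Qed.

(** An iterated commutator of [h] with elements of [S] expands into products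
    [s h s'], and one of [s], [s'] is long enough to vanish. *)
Lemma foldl_commr_nil S (i j : nat) h (w : seq R) :
    (S ^+ i * <[h]> = 0)%VS -> (<[h]> * S ^+ j = 0)%VS ->
    size w = (i + j)%N -> all (mem S) w ->
  foldl commr h w = 0.
Proof.
elim: w i j h => [|s w IH] i j h.
  case: i => // _ + /esym; rewrite add0n => + j0; rewrite j0 expv0 prodv1 => h0.
  by have := memv_line h; rewrite h0 memv0 => /eqP.
case: i => [|i] /=.
  rewrite expv0 prod1v => h0 _ _ _.
  have := memv_line h; rewrite h0 memv0 => /eqP->.
  have [f fE] := foldl_commr_linear (s :: w).
  by have := fE 0; rewrite linear0.
case: j => [|j] /=.
  rewrite expv0 prodv1 => _ h0 _ _.
  have := memv_line h; rewrite h0 memv0 => /eqP->.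
  have [f fE] := foldl_commr_linear (s :: w).
  by have := fE 0; rewrite linear0.
move=> Sh hS [sz] /andP[sS wS].
have [f fE] := foldl_commr_linear w.
rewrite -fE /commr linearB !fE.
have -> : foldl commr (h * s) w = 0.
  apply: (IH i.+1 j) => //.
  - by rewrite -prodv_line prodvA Sh prod0v.
  - apply/eqP; rewrite -subv0 -hS expvSl prodvA prodvSl // -prodv_line.
    by rewrite prodvSr.
  - by rewrite sz addnS.
have -> : foldl commr (s * h) w = 0.
  apply: (IH i j.+1) => //.
  - apply/eqP; rewrite -subv0 -Sh expvSr -prodvA prodvSr // -prodv_line.
    by rewrite prodvSl.
  - by rewrite -prodv_line -prodvA hS prodv0.
by rewrite subrr.
Qed.

Lemma derivationv_exp S z k x :
  {in S, forall s, commr z s \in S} -> x \in (S ^+ k)%VS ->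
  commr z x \in (S ^+ k)%VS.
Proof.
move=> zS; elim: k x => [|k IH] x.
  rewrite expv0 => /vlineP[c ->].
  by rewrite linearZ /= /commr mulr1 mul1r subrr scaler0 mem0v.
rewrite expvSr => xSS.
have : (S ^+ k * S <= linfun (commr z) @^-1: (S ^+ k * S))%VS.
  apply/prodvP => a b aS bS; rewrite -memv_preim lfunE /=.
  by rewrite commr_derivation memvD ?memv_mul ?IH ?zS.
by move/subvP/(_ x xSS); rewrite -memv_preim lfunE.
Qed.

(** The left ideals generated by the powers of [S] are a decreasing filtration
    of the whole algebra, stable under right multiplication by the normalizer of
    [S] and shifted by [S] itself; they take the place of the flag that [S]
    defines on a module. *)
Definition lideal S k : {vspace R} := (fullv * S ^+ k)%VS.

Lemma lideal0 S : lideal S 0 = fullv.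
Proof. by rewrite /lideal expv0 prodv1. Qed.

Lemma lidealSr S k : (lideal S k * S)%VS = lideal S k.+1.
Proof. by rewrite /lideal expvSr prodvA. Qed.

Lemma lideal_desc S k : (lideal S k.+1 <= lideal S k)%VS.
Proof. by rewrite /lideal expvSl prodvA prodvSl ?subvf. Qed.

Lemma lideal_normal S z k :
  {in S, forall s, commr z s \in S} -> (lideal S k * <[z]> <= lideal S k)%VS.
Proof.
move=> zS; rewrite -prodvA; apply/prodvP => m _ _ /memv_cosetP[x xS ->].
have -> : x * z = z * x - commr z x by rewrite /commr opprB addrC subrK.
by rewrite mulrBr mulrA rpredB ?memv_mul ?memvf ?derivationv_exp.
Qed.

(** A word of length [p] in elements of [S] and [z] either has a letter in [S],
    and so moves one step down the filtration [lideal S], or is [z ^+ p = 0]. *)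
Lemma expv_nil_extend S z N p :
    (S ^+ N = 0)%VS -> z ^+ p = 0 -> {in S, forall s, commr z s \in S} ->
  ((S + <[z]>) ^+ (p * N) = 0)%VS.
Proof.
move=> SN zp zS; set T := (S + <[z]>)%VS.
have MT k j : (lideal S k * T ^+ j <= lideal S k * <[z ^+ j]> + lideal S k.+1)%VS.
  elim: j => [|j IH]; first by rewrite expv0 expr0 addvSl.
  rewrite expvSr prodvA; apply: subv_trans (prodvSl T IH) _.
  rewrite prodvDl /T !prodvDr !subv_add -(prodvA _ <[z ^+ j]> <[z]>)%VS.
  rewrite prodv_line -exprSr addvSl /=.
  rewrite !(subv_trans _ (addvSr _ _)) ?lideal_normal ?lidealSr ?lideal_desc //.
  rewrite -lidealSr prodvSl //.
  elim: j {IH} => [|j IH]; first by rewrite expr0 prodv1.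
  by rewrite exprSr -prodv_line prodvA (subv_trans (prodvSl _ IH)) ?lideal_normal.
have MTp k : (lideal S k * T ^+ p <= lideal S k.+1)%VS.
  have := MT k p; rewrite zp.
  have -> : <[0 : R]>%VS = 0%VS by apply/eqP; rewrite -subv0 -memvE mem0v.
  by rewrite prodv0 add0v.
have MTk k : (T ^+ (p * k) <= lideal S k)%VS.
  elim: k => [|k IH]; first by rewrite lideal0 subvf.
  by rewrite mulnS addnC expvD (subv_trans (prodvSl _ IH)).
by apply/eqP; rewrite -subv0 (subv_trans (MTk N)) // /lideal SN prodv0.
Qed.

(** Engel's theorem in associative form.  A subalgebra [S] of [H] with
    nilpotent products that is not all of [H] can be enlarged by a normalizing
    element [z], which exists since iterated commutators with [S] vanish. *)
Theorem engel H :
    {in H & H, forall a b, commr a b \in H} ->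
    {in H, forall x, exists k, x ^+ k = 0} ->
  exists N, (H ^+ N = 0)%VS.
Proof.
move=> HH Hnil.
suff grow m S N : (S ^+ N = 0)%VS -> {in S & S, forall a b, commr a b \in S} ->
    (S <= H)%VS -> (\dim H - \dim S < m)%N -> exists N, (H ^+ N = 0)%VS.
  apply: (grow (\dim H).+1 0%VS 1%N); rewrite ?expv1 ?sub0v ?ltnS ?leq_subr //.
  by move=> a b; rewrite !memv0 => /eqP-> _; rewrite /commr mul0r mulr0 subrr.
elim: m S N => // m IH S N SN SS SH lt_m.
case: (boolP (H <= S)%VS) => [HS|].
  exists N; have -> : H = S by apply/eqP; rewrite eqEsubv HS SH.
  exact: SN.
case/subvPn => h hH hS.
have [z [zH zS zSS]] : exists z, [/\ z \in H, z \notin S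
    & {in S, forall s, commr z s \in S}].
  apply: (ex_normalizing (m := (N + N)%N) HH SH hH hS) => s sz sS.
  by apply: (foldl_commr_nil _ _ sz sS); rewrite SN ?prod0v ?prodv0.
have [p zp] := Hnil z zH.
have SzH : (S + <[z]> <= H)%VS by rewrite subv_add SH -memvE.
apply: (IH (S + <[z]>)%VS (p * N)%N) => //.
- exact: expv_nil_extend.
- move=> a b /memv_addP[s sS [_ /vlineP[c ->] ->]].
  move=> /memv_addP[t tS [_ /vlineP[d ->] ->]].
  apply: (subvP (addvSl S <[z]>)).
  have zc x e : commr x z \in S -> commr x (e *: z) \in S.
    by rewrite linearZ; apply: memvZ.
  have sz u : u \in S -> commr u z \in S by move=> uS; rewrite commrC rpredN zSS.
  rewrite linearD rpredD //=; last apply/zc.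
    by rewrite commrC rpredN linearD rpredD ?(SS t s) //; apply: zc; exact: sz.
  rewrite commrC rpredN linearD rpredD ?(zSS s) //.
  by apply/zc; rewrite /commr subrr mem0v.
have lt_dim : (\dim S < \dim (S + <[z]>))%N.
  rewrite ltn_neqAle dimvS ?addvSl // andbT.
  rewrite (dimv_leqif_sup (addvSl S <[z]>)) subv_add -memvE (negPf zS) andbF //.
rewrite -ltnS (leq_trans _ lt_m) // ltnS ltn_sub2l //.
exact: leq_trans lt_dim (dimvS SzH).
Qed.
End Commutator.

(** * Derived algebras of solvable linear Lie algebras *)

Section Derived.
Context {F : fieldType} {R : falgType F}.
Implicit Types (a b c : R) (U V I g : {vspace R}).

Definition derv k g : {vspace R} := iter k (fun U => commv U U) g.

Definition lie_closed g := {in g & g, forall a b, commr a b \in g}.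
(** Only normalization by [g] is asked; inclusion of [I] in [g] is a separate
    hypothesis. *)
Definition lie_ideal g I := {in g & I, forall a b, commr a b \in I}.

Lemma commv_sub g : lie_closed g -> (commv g g <= g)%VS.
Proof. exact: commvP. Qed.

Lemma commr_jacobi a b c :
  commr a (commr b c) = commr (commr a b) c + commr b (commr a c).
Proof.
rewrite [commr b c]/(b * c - c * b) linearB /= !commr_derivation opprD.
by rewrite [- _ + _]addrC addrACA.
Qed.

Lemma commv_ideal g I : lie_ideal g I -> lie_ideal g (commv I I).
Proof.
move=> gI a x ag; move: x; apply: commv_ind.
  split=> [|c x y xI yI]; first by rewrite linear0 mem0v.
  by rewrite linearP memvD // memvZ.
by move=> b c bI cI /=; rewrite commr_jacobi memvD ?mem_commv ?gI.
Qed.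

Lemma lie_closed_ideal g I : (I <= g)%VS -> lie_ideal g I -> lie_closed I.
Proof. by move=> /subvP sIg gI a b /sIg; apply: gI. Qed.
End Derived.

Section Solvable.
Context {F : fieldType} {n : nat}.
Hypothesis charF : [pchar F] =i pred0.
Local Notation R := 'M[F]_n.+1.
Implicit Types (U V I P B g : {vspace R}).

(** The elements of the algebra that preserve the filtration [lideal I]
    ([stab]) contain [B], and those that shift it down ([rad]) form a two-sided
    ideal of nilpotent elements in them, containing [I].  As [commr d a] lies in
    [I], the commutator of [e = d ^+ k] with [a] lies in [rad], and
    [\tr (e * commr a b) = \tr (commr e a * b) = 0].  So all positive powers of
    [d] have trace 0. *)
Lemma commutator_nilpotent I P B N d :
    (I ^+ N = 0)%VS -> lie_ideal B I -> (P <= B)%VS ->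
    d \in commv P B -> d \in B -> {in P, forall a, commr d a \in I} ->
  exists k, d ^+ k = 0.
Proof.
move=> IN BI /subvP sPB dPB dB dP.
pose stab (t : R) := forall k m, m \in lideal I k -> m * t \in lideal I k.
pose rad (t : R) := forall k m, m \in lideal I k -> m * t \in lideal I k.+1.
have stabB b : b \in B -> stab b.
  move=> bB k m mk; have /subvP := lideal_normal k (fun s => BI b s bB); apply.
  by rewrite memv_mul ?memv_line.
have radI s : s \in I -> rad s.
  by move=> sI k m mk; rewrite -lidealSr memv_mul.
have stabM s t : stab s -> stab t -> stab (s * t).
  by move=> Ss St k m mk; rewrite mulrA; apply/St/Ss.
have radMl s t : stab s -> rad t -> rad (s * t).
  by move=> Ss St k m mk; rewrite mulrA; apply/St/Ss.
have radMr s t : rad s -> stab t -> rad (s * t).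
  by move=> Ss St k m mk; rewrite mulrA; apply/St/Ss.
have radD s t : rad s -> rad t -> rad (s + t).
  by move=> Ss St k m mk; rewrite mulrDr memvD ?Ss ?St.
have tr_rad t : rad t -> \tr t = 0.
  move=> Rt; apply: (@mxtrace_nilpotent _ _ _ N).
  have tk k : t ^+ k \in lideal I k.
    elim: k => [|k IHk]; first by rewrite lideal0 memvf.
    by rewrite exprSr Rt.
  by have := tk N; rewrite /lideal IN prodv0 memv0 => /eqP.
have stabX k : stab (d ^+ k).
  elim: k => [|k IHk]; first by move=> k m; rewrite mulr1.
  by rewrite exprS; apply: stabM => //; apply: stabB.
have comX k a : a \in P -> rad (commr (d ^+ k) a).
  move=> aP; elim: k => [|k IHk].
    by move=> k m mk; rewrite /commr mul1r mulr1 subrr mulr0 mem0v.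
  have -> : commr (d ^+ k.+1) a = d * commr (d ^+ k) a + commr d a * d ^+ k.
    rewrite exprS ![commr _ a]commrC commr_derivation.
    by rewrite opprD mulNr mulrN addrC.
  apply: radD; first by apply: radMl => //; apply: stabB.
  by apply: radMr => //; apply/radI/dP.
apply: nilpotent_mxtrace => // k; rewrite exprSr.
move: (d ^+ k) (comX k) => e comE; move: d dPB {dB dP stabX comX}.
apply: commv_ind => [|a b aP bB].
  split=> [|c x y trx try]; first by rewrite mulr0 mxtrace0.
  by rewrite mulrDr -scalerAr mxtraceD mxtraceZ trx try mulr0 addr0.
have -> : \tr (e * commr a b) = \tr (commr e a * b).
  rewrite /commr mulrBr mulrBl !raddfB /= !mulrA; congr (_ - _).
  exact: etrans (mxtrace_mulC (e * b) a) (congr1 _ (mulrA a e b)).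
by apply: tr_rad; apply: radMr; [apply: comE|apply: stabB].
Qed.

(** Induction on the derived length, applied to [g' = commv g g]: long products
    in [commv g' g'] vanish.  The criterion [commutator_nilpotent] is then used
    twice, first for [I = commv g' g] modulo [commv g' g'], then for [g'] modulo
    [I]; modulo these ideals each element considered commutes with the left
    entries of the commutators it is a sum of. *)
Theorem solvable_derived_nilpotent g k :
  lie_closed g -> derv k g = 0%VS -> exists N, (commv g g ^+ N = 0)%VS.
Proof.
elim: k g => [|k IH] g gg gk.
  exists 1%N; apply/eqP; rewrite expv1 -subv0 (subv_trans (commv_sub gg)) //.
  by rewrite [g](gk : g = 0%VS).
set g' := commv g g.
have sg' : (g' <= g)%VS by apply: commv_sub.
have gg' : lie_ideal g g' by move=> a b ag /(subvP sg'); apply: mem_commv.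
have g'g' : lie_closed g' by apply: lie_closed_ideal gg'.
have [N g''N] : exists N, (commv g' g' ^+ N = 0)%VS.
  by apply: IH => //; rewrite -gk /derv iterSr.
pose I := commv g' g.
have sIg' : (I <= g')%VS.
  by apply: commvP => a b ag bg; rewrite commrC memvN gg'.
have gI : lie_ideal g I.
  by move=> a b ag bI; rewrite commrC memvN mem_commv // (subvP sIg').
have [M IM] : exists M, (I ^+ M = 0)%VS.
  apply: engel; first by apply: lie_closed_ideal gI; apply: subv_trans sg'.
  move=> d dI; apply: (@commutator_nilpotent (commv g' g') g' g N) => //.
  - exact: commv_ideal.
  - by rewrite (subvP sg') ?(subvP sIg').
  - by move=> a ag; rewrite mem_commv // (subvP sIg').
apply: engel => // d dg'; apply: (@commutator_nilpotent I g g M) => //.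
- by rewrite (subvP sg').
- by move=> a ag; rewrite mem_commv.
Qed.
End Solvable.

(** * Splitting fields and rational numbers in characteristic 0 *)

Lemma irreducible_divisor (F : fieldType) (p : {poly F}) :
  (1 < size p)%N -> exists2 q, irreducible_poly q & q %| p.
Proof.
have [m] := ubnP (size p); elim: m p => // m IH p lt_pm p_gt1.
case: (pselect (irreducible_poly p)) => [|red]; first by exists p.
have [q [q1 qp neq]] : exists q : {poly F}, [/\ size q != 1%N, q %| p & ~ q %= p].
  apply: contrapT => /forallNP H; apply: red; split=> // q q1 qp.
  by apply: contrapT => neq; apply: (H q); split.
have p0 : p != 0 by rewrite -size_poly_gt0 ltnW.
have q0 : q != 0 by apply: contraTneq qp => ->; rewrite dvd0p.
have lt_qp : (size q < size p)%N.
  rewrite ltn_neqAle dvdp_leq // andbT; apply/negP => /eqP E.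
  by apply: neq; rewrite -(dvdp_size_eqp qp) E.
have q_gt1 : (1 < size q)%N by rewrite ltn_neqAle eq_sym q1 size_poly_gt0.
have [r irr rq] := IH q (leq_trans lt_qp lt_pm) q_gt1.
by exists r => //; apply: dvdp_trans qp.
Qed.

(** Adjoin a root of an irreducible factor and divide by the corresponding
    linear factor. *)
Lemma splitting_extension (F : fieldType) (p : {poly F}) : p != 0 ->
  exists (K : fieldType) (iota : {rmorphism F -> K}) (rs : seq K),
    map_poly iota p %= \prod_(z <- rs) ('X - z%:P).
Proof.
have [m] := ubnP (size p); elim: m F p => // m IH F p lt_pm p0.
have [le_p1|p_gt1] := leqP (size p) 1.
  exists F, idfun, [::]; rewrite big_nil map_poly_id // -size_poly_eq1.
  by rewrite eqn_leq le_p1 size_poly_gt0.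
have [q irr qp] := irreducible_divisor p_gt1.
have [L _ [z qz _]] := irredp_FAdjoin irr.
pose j : {rmorphism F -> L} := GRing.in_alg L.
have : root (map_poly j p) z.
  rewrite -dvdp_XsubCl (dvdp_trans (_ : _ %| map_poly j q)) ?dvdp_map //.
  by rewrite dvdp_XsubCl.
case/factor_theorem => p1 Dp.
have jp0 : map_poly j p != 0 by rewrite map_poly_eq0.
have p10 : p1 != 0 by apply: contraNneq jp0 => p1_0; rewrite Dp p1_0 mul0r.
have [||K [i [rs E]]] := IH L p1 => //.
  move: lt_pm; rewrite -(size_map_poly j) Dp size_Mmonic ?monicXsubC //.
  by rewrite size_XsubC addn2.
exists K, (i \o j), (i z :: rs).
rewrite map_poly_comp Dp rmorphM /= map_polyXsubC big_cons mulrC.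
exact: eqp_mull.
Qed.

Lemma intr_neq0 (K : fieldType) (z : int) :
  [pchar K] =i pred0 -> z != 0 -> z%:~R != 0 :> K.
Proof.
move=> /pcharf0P charK; case: z => [[|n] //|n] _; first exact: negbT (charK n.+1).
by rewrite NegzE mulrNz oppr_eq0; exact: negbT (charK n.+1).
Qed.

(** The map is [ratr], which respects fractions as soon as nonzero integers
    stay nonzero. *)
Lemma rat_embedding (K : fieldType) :
  [pchar K] =i pred0 -> exists psi : {rmorphism rat -> K}, True.
Proof.
move=> charK; have nz := intr_neq0 charK.
have ratrE (n d : int) : d != 0 -> ratr (n%:~R / d%:~R) = n%:~R / d%:~R :> K.
  move=> d0; rewrite /ratr; set q : rat := n%:~R / d%:~R.
  apply/eqP; rewrite eqr_div ?nz ?denq_neq0 // -!intrM; apply/eqP.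
  congr (_%:~R); apply: (@intr_inj rat).
  by rewrite !intrM numqE /q mulrAC divfK // intr_eq0.
have ratrB : zmod_morphism (@ratr K).
  move=> x y; rewrite -{1}[x]divq_num_den -{1}[y]divq_num_den -mulNr.
  rewrite addf_div ?intr_eq0 ?denq_neq0 //.
  rewrite -!(intrN, intrM, intrD) ratrE ?mulf_neq0 ?denq_neq0 //.
  by rewrite /ratr -mulNr addf_div ?nz ?denq_neq0 // !(intrM, intrD, intrN).
have ratrM : monoid_morphism (@ratr K).
  split=> [|x y]; first by rewrite (ratr_int K 1).
  rewrite -{1}[x]divq_num_den -{1}[y]divq_num_den mulf_div -!intrM.
  by rewrite ratrE ?mulf_neq0 ?denq_neq0 // /ratr mulf_div !intrM.
pose aM := GRing.isZmodMorphism.Build _ _ (@ratr K) ratrB.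
pose mM := GRing.isMonoidMorphism.Build _ _ (@ratr K) ratrM.
pose psi : {rmorphism rat -> K} := HB.pack (@ratr K) aM mM.
by exists psi.
Qed.

(** * Generalized eigenprojections and stable subspaces *)

Lemma coprimep_XsubC_prod (K : fieldType) (z : K) (s : seq K) N :
  z \notin s -> coprimep (('X - z%:P) ^+ N) (\prod_(w <- s) ('X - w%:P) ^+ N).
Proof.
move=> zs; rewrite big_seq; elim/big_rec: _ => [|w p ws cop]; first exact: coprimep1.
rewrite coprimepMr cop andbT coprimep_expl // coprimep_expr //.
rewrite coprimep_XsubC root_XsubC; apply: contraNneq zs => <-; exact: ws.
Qed.

Lemma dvdp_prod_XsubC (K : fieldType) (s : seq K) N (q : {poly K}) :
  uniq s -> (forall z, z \in s -> ('X - z%:P) ^+ N %| q) ->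
  \prod_(z <- s) ('X - z%:P) ^+ N %| q.
Proof.
elim: s => [|z s IH] /=; first by rewrite big_nil dvd1p.
move=> /andP[zs us] dv; rewrite big_cons Gauss_dvdp ?coprimep_XsubC_prod //.
rewrite dv ?mem_head //; apply: IH => // w ws; apply: dv.
by rewrite inE ws orbT.
Qed.

(** The projections are polynomials in [x], given by the Bezout relations
    between [(X - z)^N] and the product of the other such powers.  Those that
    vanish are dropped, so that every index carries a nonzero eigenspace. *)
Lemma generalized_eigenprojections (K : fieldType) n (x : 'M[K]_n.+1) rs :
    char_poly x %= \prod_(z <- rs) ('X - z%:P) ->
  exists (m N : nat) (lam : 'I_m -> K) (p : 'I_m -> 'M[K]_n.+1),
  [/\ injective lam, \sum_i p i = 1,
      forall i j, p i * p j = if i == j then p i else 0,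
      forall i, p i != 0
    & forall i, x * p i = p i * x /\ (x - (lam i)%:M) ^+ N * p i = 0].
Proof.
move=> split_x; set s := undup rs; pose N := size rs.
pose Phi := \prod_(z <- s) ('X - z%:P) ^+ N.
pose Phi' z := \prod_(w <- s | w != z) ('X - w%:P) ^+ N.
have us : uniq s by apply: undup_uniq.
have PhiE z : z \in s -> Phi = ('X - z%:P) ^+ N * Phi' z.
  by move=> zs; rewrite /Phi (bigD1_seq z).
have Phi0 q : Phi %| q -> horner_mx x q = 0.
  move=> Phiq; suff /dvdpP[u ->] : char_poly x %| q.
    by rewrite rmorphM /= Cayley_Hamilton mulr0.
  apply: dvdp_trans Phiq; rewrite (eqp_dvdl _ split_x) -prodr_undup_exp_count.
  rewrite /Phi -/s; elim: (s) => [|z t IH]; first by rewrite !big_nil dvd1p.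
  by rewrite !big_cons dvdp_mul // dvdp_exp2l // count_size.
have /choice[e eP] : forall z, exists q : {poly K}, z \in s ->
    Phi' z %| q /\ ('X - z%:P) ^+ N %| q - 1.
  move=> z; case: (boolP (z \in s)) => [zs|_]; last by exists 0.
  have cop : coprimep (('X - z%:P) ^+ N) (Phi' z).
    by rewrite /Phi' -big_filter coprimep_XsubC_prod // mem_filter eqxx.
  have /Bezout_eq1_coprimepP[[u v] /= uv1] := cop.
  exists (v * Phi' z) => _; rewrite dvdp_mull //; split=> //.
  by rewrite -uv1 opprD addrCA subrr addr0 -mulNr dvdp_mull.
have XdvdPhi' z w : z \in s -> z != w -> ('X - z%:P) ^+ N %| Phi' w.
  move=> zs zw; rewrite /Phi' -big_filter (bigD1_seq z) ?filter_uniq //=.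
    exact: dvdp_mulr.
  by rewrite mem_filter zw.
pose P z := horner_mx x (e z).
have Pkill z : z \in s -> horner_mx x (('X - z%:P) ^+ N) * P z = 0.
  move=> zs; rewrite -rmorphM /= Phi0 // (PhiE z zs) dvdp_mul //; exact: (eP z zs).1.
have PP z w : z \in s -> w \in s -> P z * P w = if z == w then P z else 0.
  move=> zs ws; case: eqVneq => [<-{w ws}|zw].
    apply/eqP; rewrite -subr_eq0 -[X in _ - X]mulr1 -mulrBr; apply/eqP.
    rewrite -(rmorph1 (horner_mx x)) -rmorphB -rmorphM /= Phi0 // (PhiE z zs) mulrC.
    by have [? ?] := eP z zs; rewrite dvdp_mul.
  rewrite -rmorphM /= Phi0 // (PhiE w ws) dvdp_mul //; last exact: (eP w ws).1.
  by apply: dvdp_trans (eP z zs).1; apply: XdvdPhi'; rewrite // eq_sym.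
have P1 : \sum_(z <- s) P z = 1.
  apply/eqP; rewrite -subr_eq0 -rmorph_sum -(rmorph1 (horner_mx x)) -rmorphB /=.
  apply/eqP/Phi0/dvdp_prod_XsubC => // z zs.
  rewrite (bigD1_seq z) //= addrAC dvdp_add //; first exact: (eP z zs).2.
  rewrite big_seq_cond; elim/big_rec: _ => [|w q /andP[ws wz] dq]; first exact: dvdp0.
  by rewrite dvdp_add // (dvdp_trans _ (eP w ws).1) // XdvdPhi' // eq_sym.
pose t := [seq z <- s | P z != 0].
have tP z : z \in t -> P z != 0 /\ z \in s by rewrite mem_filter => /andP.
have ut : uniq t by apply: filter_uniq.
have P1t : \sum_(z <- t) P z = 1.
  rewrite -P1 big_filter [RHS](bigID (fun z => P z != 0)) /=.
  by rewrite [X in _ + X]big1 ?addr0 // => z /negPn/eqP.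
exists (size t), N, (fun i => t`_i), (fun i => P t`_i).
have tiP (i : 'I_(size t)) := tP _ (mem_nth 0 (ltn_ord i)).
have tN (z : K) : (x - z%:M) ^+ N = horner_mx x (('X - z%:P) ^+ N).
  by rewrite rmorphXn rmorphB /= horner_mx_X horner_mx_C.
split.
- by move=> i j /eqP; rewrite nth_uniq // => /eqP/val_inj.
- by rewrite -P1t (big_nth 0) big_mkord.
- move=> i j; rewrite PP ?(tiP i).2 ?(tiP j).2 // nth_uniq //.
- by move=> i; exact: (tiP i).1.
- move=> i; rewrite tN; split; last exact/Pkill/(tiP i).2.
  by rewrite -[in LHS](horner_mx_X x) -[in RHS](horner_mx_X x) -!rmorphM mulrC.
Qed.

Section StableSubspace.
Variables (K : fieldType) (V : lmodType K) (T : {linear V -> V}) (U : V -> Prop).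
Hypotheses (linU : linear_pred U) (TU : forall v, U v -> U (T v)).

Definition shift a (v : V) := T v - a *: v.

Lemma shift_linear a : linear (shift a).
Proof.
move=> c u v; rewrite /shift linearP scalerDr !scalerA mulrC -scalerA scalerBr.
by rewrite opprD addrACA.
Qed.
HB.instance Definition _ a := GRing.isLinear.Build K V V *:%R (shift a) (shift_linear a).

Lemma shiftC a b v : shift a (shift b v) = shift b (shift a v).
Proof.
rewrite /shift !linearB /= !linearZ /= !scalerA [b * a]mulrC.
exact: addrACA.
Qed.

Lemma iter_shiftC a N d M v :
  iter N (shift a) (iter M (shift d) v) = iter M (shift d) (iter N (shift a) v).
Proof.
elim: N v => //= N IH v; rewrite IH; elim: M {IH} => //= M IH.
by rewrite shiftC IH.
Qed.

Lemma iter_shift_linear a N : linear (iter N (shift a)).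
Proof. by move=> c u v; elim: N => //= N ->; rewrite linearP. Qed.

Lemma additive_iter a N : {morph iter N (shift a) : u v / u + v}.
Proof. by move=> u v; rewrite -[u]scale1r iter_shift_linear !scale1r. Qed.

Lemma stable_shift a v : U v -> U (shift a v).
Proof. by move=> Uv; rewrite /shift addrC -scaleNr; apply: linU.2 => //; apply: TU. Qed.

(** On vectors killed by a power of [T - d] the map [T - a] is invertible;
    the induction on that power replaces an inverse polynomial in [T]. *)
Lemma mem_of_shift a d N w :
  a != d -> iter N (shift d) w = 0 -> U (shift a w) -> U w.
Proof.
move=> ad; elim: N w => [|N IH] w; first by move=> /= ->; case: linU.
rewrite iterSr => dw Uaw.
have Udw : U (shift d w) by apply: IH => //; rewrite shiftC; apply: stable_shift.
have Dw : shift a w - shift d w = (d - a) *: w.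
  by rewrite /shift opprB scalerBl addrC addrA subrK.
have -> : w = (d - a)^-1 *: (shift a w - shift d w).
  by rewrite Dw scalerA mulVf ?scale1r // subr_eq0 eq_sym.
rewrite -[_ *: _]addr0; apply: linU.2; last by case: linU.
by rewrite addrC -scaleN1r; apply: linU.2.
Qed.

Lemma iter_shift0 a N : iter N (shift a) 0 = 0.
Proof. by elim: N => //= N ->; rewrite linear0. Qed.

Lemma mem_of_iter_shift a d N M w :
  a != d -> iter N (shift d) w = 0 -> U (iter M (shift a) w) -> U w.
Proof.
move=> ad dw; elim: M => //= M IH Ua; apply: IH; apply: (@mem_of_shift a d N) Ua => //.
by rewrite iter_shiftC dw iter_shift0.
Qed.

Lemma stable_iter_shift a N v : U v -> U (iter N (shift a) v).
Proof. by move=> Uv; elim: N => //= N IH; apply: stable_shift. Qed.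

(** A [T]-stable subspace contains the generalized eigencomponents of its
    elements: applying a power of [T - a] removes the component at [a] from the
    sum and can be undone on the others. *)
Lemma stable_components (s : seq K) (w : K -> V) N :
    uniq s -> (forall d, d \in s -> iter N (shift d) (w d) = 0) ->
    U (\sum_(d <- s) w d) ->
  forall d, d \in s -> U (w d).
Proof.
elim: s w => // a s IH w /= /andP[sa us] wN.
rewrite big_cons => Uw.
have Us d : d \in s -> U (w d).
  move=> ds; apply: (@mem_of_iter_shift a d N N).
  - by apply: contraNneq sa => ->.
  - by rewrite wN // inE ds orbT.
  move: d ds; apply: (IH (fun d => iter N (shift a) (w d))) => // [d ds|].
    by rewrite iter_shiftC wN ?iter_shift0 // inE ds orbT.
  have iterD := additive_iter a N.
  have := stable_iter_shift a N Uw; rewrite iterD wN ?mem_head // add0r.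
  rewrite (big_morph _ iterD (iter_shift0 a N)) //.
move=> d; rewrite inE => /predU1P[->|/Us//].
have -> : w a = (w a + \sum_(d <- s) w d) - \sum_(d <- s) w d by rewrite addrK.
rewrite addrC -scaleN1r; apply: linU.2 => //.
under eq_bigr do rewrite -[w _]scale1r.
by rewrite big_seq; apply: linear_pred_sum.
Qed.
End StableSubspace.

(** * Cartan's criterion *)

(** Left multiplication by [a] and right multiplication by [c] commute, so this
    is the binomial expansion of a power of their difference. *)
Lemma iter_sandwich_nil (R : pzRingType) (a c : R) i j w :
  a ^+ i * w = 0 -> w * c ^+ j = 0 -> iter (i + j) (fun z => a * z - z * c) w = 0.
Proof.
set D := fun z => _.
have DB u v : D (u - v) = D u - D v.
  by rewrite /D mulrBr mulrBl opprD addrACA -opprD.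
have D0 : D 0 = 0 by rewrite /D mulr0 mul0r subrr.
have it0 N : iter N D 0 = 0 by elim: N => //= N ->.
have itB N u v : iter N D (u - v) = iter N D u - iter N D v.
  by elim: N => //= N ->.
have [m] := ubnP (i + j); elim: m i j w => // m IH [|i] j w.
  by rewrite expr0 mul1r => _ ->; rewrite it0.
case: j => [|j]; first by rewrite expr0 mulr1 => _ _ ->; rewrite it0.
move=> lt_m aw wc.
have lt1 : (i + j.+1 < m)%N by [].
have lt2 : (i.+1 + j < m)%N by rewrite addSnnS.
rewrite addSn iterSr itB.
have wc' : a ^+ i.+1 * (w * c) = 0 by rewrite mulrA aw mul0r.
have aw' : a ^+ i * (a * w) = 0 by rewrite mulrA -exprSr.
have wc2 : w * c * c ^+ j = 0 by rewrite -mulrA -exprS.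
have aw2 : a * w * c ^+ j.+1 = 0 by rewrite -mulrA wc mulr0.
by rewrite (IH i j.+1) // -addSnnS (IH i.+1 j) // subrr.
Qed.

(** For a matrix [B] whose rows form a basis of [U], the rows of the kernel of
    [B^T] are orthogonal to [U]; if they vanish, [B] has rank [m]. *)
Lemma orthogonal_zero_full (m : nat) (U : {vspace 'rV[rat]_m}) :
    (forall mu : 'rV[rat]_m, (forall c, c \in U -> \sum_i c 0 i * mu 0 i = 0) -> mu = 0) ->
  U = fullv.
Proof.
move=> orth; pose B := \matrix_(i < \dim U) (vbasis U)`_i.
have kerB : kermx B^T = 0.
  apply/row_matrixP => i; rewrite row0; apply: orth => c /coord_vbasis ->.
  move: (coord _) => co.
  have /(congr1 (row i)) := mulmx_ker B^T.
  rewrite row_mul row0; move: (row i _) => k kB.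
  have kb (l : 'I_(\dim U)) : \sum_j (vbasis U)`_l 0 j * k 0 j = 0.
    have := congr1 (fun v : 'rV_(\dim U) => v 0 l) kB; rewrite !mxE => E.
    by rewrite -[RHS]E; apply: eq_bigr => j _; rewrite mulrC !mxE.
  under eq_bigr do rewrite summxE mulr_suml.
  rewrite exchange_big big1 // => l _.
  under eq_bigr do rewrite mxE -mulrA.
  by rewrite -mulr_sumr kb mulr0.
apply/eqP; rewrite eqEdim subvf dimvf /dim /= mul1n.
have : row_free B^T by rewrite -kermx_eq0 kerB.
rewrite /row_free mxrank_tr => /eqP rB; apply: leq_trans (rank_leq_row B).
by rewrite rB.
Qed.

Section Cartan.
Context {K : fieldType} {n : nat}.
Hypothesis charK : [pchar K] =i pred0.
Local Notation R := 'M[K]_n.+1.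

(** The choice of [mu] makes [mu_i - mu_j] depend only on [lam_i - lam_j], so
    [ad y] acts as a scalar on each generalized eigencomponent of [ad x]; since
    [H] contains the components of its elements, it is stable under [ad y]. *)
Lemma split_perfect_isotropic_nilpotent (H : {vspace R}) (x : R) (rs : seq K) :
    lie_closed H -> (H <= commv H H)%VS ->
    {in H & H, forall a b, \tr (a * b) = 0} ->
    char_poly x %= \prod_(z <- rs) ('X - z%:P) -> x \in H ->
  exists k, x ^+ k = 0.
Proof.
move=> HH perf iso split_x xH.
have [m [N [lam [p [lam_inj p1 pp p_neq0 pN]]]]] := generalized_eigenprojections split_x.
have com i : GRing.comm (x - (lam i)%:M) (p i).
  apply/commr_sym/commrB; first by have [] := pN i.
  exact: comm_mx_scalar.
have kl i : (x - (lam i)%:M) ^+ N * p i = 0 by have [] := pN i.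
have kr i : p i * (x - (lam i)%:M) ^+ N = 0.
  by rewrite -(kl i); apply/esym/commr_sym/commrX/commr_sym/com.
have [psi _] := rat_embedding charK.
pose Rel (c : 'rV[rat]_m) := \sum_i psi (c 0 i) * lam i = 0.
have linRel : linear_pred Rel.
  split=> [|d c e Rc Re].
    by rewrite /Rel big1 // => i _; rewrite mxE rmorph0 mul0r.
  rewrite /Rel; under eq_bigr do rewrite !mxE rmorphD rmorphM mulrDl -mulrA.
  by rewrite big_split /= -mulr_sumr Rc Re mulr0 addr0.
have [U UP] := vspace_of_pred linRel.
have rank_gt0 i : (0 < \rank (p i))%N by rewrite lt0n mxrank_eq0.
suff Ufull : U = fullv.
  have lam0 i : lam i = 0.
    have /UP : delta_mx 0 i \in U by rewrite Ufull memvf.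
    rewrite /Rel (bigD1 i) //= mxE !eqxx rmorph1 mul1r big1 ?addr0 // => j ji.
    by rewrite mxE (negPf ji) andbF rmorph0 mul0r.
  exists N; rewrite -[LHS]mulr1 -p1 mulr_sumr big1 // => i _.
  by rewrite -(kl i) lam0 raddf0 subr0.
apply: orthogonal_zero_full => mu mu_orth.
(* An equality between differences of eigenvalues is itself a relation. *)
have mu_diff i j k l : lam i - lam j = lam k - lam l ->
    mu 0 i - mu 0 j = mu 0 k - mu 0 l.
  move=> E; pose c : 'rV[rat]_m :=
    delta_mx 0 i - delta_mx 0 j - (delta_mx 0 k - delta_mx 0 l).
  have sumc (L : comPzRingType) (f : 'I_m -> L) (g : {rmorphism rat -> L}) :
      \sum_t g (c 0 t) * f t = f i - f j - (f k - f l).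
    have sumd a : \sum_t g ((delta_mx 0 a : 'rV_m) 0 t) * f t = f a.
      rewrite (bigD1 a) //= mxE !eqxx rmorph1 mul1r big1 ?addr0 // => t ta.
      by rewrite mxE (negPf ta) andbF rmorph0 mul0r.
    rewrite -!sumd -!sumrB; apply: eq_bigr => t _.
    by rewrite /c -!mulrBl -!rmorphB; congr (g _ * _); rewrite !mxE.
  have /UP/mu_orth : Rel c by rewrite /Rel sumc E subrr.
  by rewrite (sumc _ (mu 0) idfun) => /eqP; rewrite subr_eq0 => /eqP.
pose y := \sum_i psi (mu 0 i) *: p i.
have ypl i : y * p i = psi (mu 0 i) *: p i.
  rewrite mulr_suml (bigD1 i) //= -scalerAl pp eqxx big1 ?addr0 // => j ji.
  by rewrite -scalerAl pp (negPf ji) scaler0.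
have ypr i : p i * y = psi (mu 0 i) *: p i.
  rewrite mulr_sumr (bigD1 i) //= -scalerAr pp eqxx big1 ?addr0 // => j ji.
  by rewrite -scalerAr pp eq_sym (negPf ji) scaler0.
(* Decompose b along the generalized eigenspaces of ad x, which are indexed by
   the differences of eigenvalues. *)
have yH b : b \in H -> commr b y \in H.
  move=> bH; pose dl (q : 'I_m * 'I_m) := lam q.1 - lam q.2.
  pose t (q : 'I_m * 'I_m) : R := p q.1 * b * p q.2.
  pose s := undup [seq dl q | q <- enum {: 'I_m * 'I_m}].
  have regroup (f : 'I_m * 'I_m -> R) :
      \sum_(d <- s) \sum_(q | d == dl q) f q = \sum_q f q.
    rewrite (exchange_big_dep xpredT) //=; apply: eq_bigr => q _.
    rewrite -big_filter filter_pred1_uniq ?undup_uniq ?big_seq1 //.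
    by rewrite mem_undup map_f ?mem_enum.
  have sum_t (f : 'I_m * 'I_m -> K) :
      \sum_q f q *: t q = \sum_i \sum_j f (i, j) *: (p i * b * p j).
    by rewrite pair_big; apply: eq_bigr => -[].
  have Db : b = \sum_(d <- s) \sum_(q | d == dl q) t q.
    rewrite regroup; under eq_bigr do rewrite -[t _]scale1r.
    rewrite sum_t -[LHS]mul1r -[LHS]mulr1 -{1}p1 -p1 !mulr_suml.
    apply: eq_bigr => i _; rewrite mulr_sumr; apply: eq_bigr => j _.
    by rewrite scale1r.
  have tH d : d \in s -> \sum_(q | d == dl q) t q \in H.
    pose P v := v \in H : Prop.
    apply: (@stable_components _ _ (commr x) P _ _ s
             (fun d => \sum_(q | d == dl q) t q) (N + N)).
    - by split=> [|c u v uH vH]; rewrite /P ?mem0v // memvD // memvZ.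
    - by move=> v vH; apply: HH.
    - exact: undup_uniq.
    - move=> e _; rewrite (big_morph _ (additive_iter _ _ _) (iter_shift0 _ _ _)).
      rewrite big1 // => q /eqP ->.
      rewrite -[RHS](@iter_sandwich_nil _ (x - (lam q.1)%:M) (x - (lam q.2)%:M) N N (t q)).
      + apply: eq_iter => v; rewrite /shift /commr mulrBl mulrBr scalerBl.
        rewrite (mul_scalar_mx _ _ : (lam q.1)%:M * v = _ *: v).
        rewrite (mul_mx_scalar _ _ : v * (lam q.2)%:M = _ *: v).
        by rewrite !opprB addrACA [RHS]addrACA; congr (_ + _); rewrite addrC.
      + by rewrite /t !mulrA kl !mul0r.
      + by rewrite /t -!mulrA kr !mulr0.
    - by rewrite /P -Db.
  have -> : commr b y = \sum_q (psi (mu 0 q.2) - psi (mu 0 q.1)) *: t q.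
    under eq_bigr do rewrite scalerBl.
    rewrite sumrB !sum_t /commr; congr (_ - _).
      rewrite -{1}[b]mul1r -p1 !mulr_suml; apply: eq_bigr => i _.
      by rewrite mulr_sumr; apply: eq_bigr => j _; rewrite -scalerAr.
    rewrite -[LHS]mulr1 -p1 !mulr_suml; apply: eq_bigr => i _.
    by rewrite mulr_sumr; apply: eq_bigr => j _; rewrite -!scalerAl.
  rewrite -regroup big_seq rpred_sum // => d ds.
  case: (pickP (fun q => d == dl q)) => [q0 /eqP d0|none]; last first.
    by rewrite big_pred0 ?mem0v.
  have -> : \sum_(q | d == dl q) (psi (mu 0 q.2) - psi (mu 0 q.1)) *: t q
    = (psi (mu 0 q0.2) - psi (mu 0 q0.1)) *: \sum_(q | d == dl q) t q.
    rewrite scaler_sumr; apply: eq_bigr => q /eqP dq; congr (_ *: _).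
    rewrite -!rmorphB; congr (psi _); apply: mu_diff.
    by rewrite -[LHS]opprB -[RHS]opprB -/(dl q) -/(dl q0) -dq -d0.
  by rewrite memvZ // tH.
(* Perfectness writes x as a sum of commutators of a and b, and the trace moves
   the commutator from a to y. *)
have trxy : \tr (x * y) = 0.
  move: (subvP perf x xH); move: (x); apply: commv_ind => [|a b aH bH].
    split=> [|c u v tru trv]; first by rewrite mul0r mxtrace0.
    by rewrite mulrDl -scalerAl mxtraceD mxtraceZ tru trv mulr0 addr0.
  have -> : \tr (commr a b * y) = \tr (a * commr b y).
    rewrite /commr mulrBr mulrBl !raddfB /= !mulrA; congr (_ - _).
    exact: etrans (congr1 _ (esym (mulrA b a y))) (mxtrace_mulC b (a * y)).
  by rewrite iso ?yH.
have trp i : \tr (x * p i) = lam i * (\rank (p i))%:R.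
  have pii : p i * p i = p i by rewrite pp eqxx.
  have xp : x * p i = (x - (lam i)%:M) * p i + lam i *: p i.
    by rewrite mulrBl (mul_scalar_mx _ _ : (lam i)%:M * p i = lam i *: p i) subrK.
  (* One more than N, so that a factor p i is left when N is 0. *)
  have nil : ((x - (lam i)%:M) * p i) ^+ N.+1 = 0.
    rewrite exprMn_comm // exprS [p i ^+ _]exprS -mulrA.
    by rewrite [_ ^+ N * (_ * _)]mulrA kl mul0r mulr0.
  have tr0 : \tr ((x - (lam i)%:M) * p i) = 0 := mxtrace_nilpotent nil.
  have -> : \tr (x * p i) = \tr ((x - (lam i)%:M) * p i) + lam i * \tr (p i).
    by rewrite {1}xp raddfD /= mxtraceZ.
  by rewrite tr0 add0r mxtrace_idempotent.
have Relmu : Rel (\row_i (mu 0 i * (\rank (p i))%:R)).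
  rewrite /Rel; apply: etrans trxy; rewrite mulr_sumr raddf_sum /=; apply: eq_bigr => i _.
  rewrite mxE rmorphM rmorph_nat -scalerAr mxtraceZ trp; ring.
have := mu_orth _ ((UP _).2 Relmu).
under eq_bigr do rewrite mxE mulrAC -expr2.
move=> /eqP; rewrite psumr_eq0 => [/allP mu0|i _]; last by rewrite mulr_ge0 ?sqr_ge0 ?ler0n.
apply/rowP => i; have := mu0 i (mem_index_enum _).
by rewrite mulf_eq0 sqrf_eq0 pnatr_eq0 -[_ == 0%N]negbK -lt0n rank_gt0 orbF mxE => /eqP.
Qed.

End Cartan.

Section CartanCriterion.
Context {F : fieldType} {n : nat}.
Hypothesis charF : [pchar F] =i pred0.
Local Notation R := 'M[F]_n.+1.
Implicit Types H g : {vspace R}.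

(** Perfectness and isotropy are inherited by the span [HK] of [H] over a
    splitting field of the characteristic polynomial of [x]. *)
Lemma perfect_isotropic_nilpotent H :
    commv H H = H -> {in H & H, forall a b, \tr (a * b) = 0} ->
  {in H, forall x, exists k, x ^+ k = 0}.
Proof.
move=> perf iso x xH.
have p0 : char_poly x != 0 by rewrite monic_neq0 ?char_poly_monic.
have [K [j [rs]]] := splitting_extension p0.
rewrite map_char_poly; set xK := map_mx j x => split_x.
have charK : [pchar K] =i pred0 by move=> q; rewrite (fmorph_pchar j) charF.
pose HK : {vspace 'M[K]_n.+1} := <<[seq map_mx j h | h <- vbasis H]>>%VS.
have jH h : h \in H -> map_mx j h \in HK.
  move=> /coord_vbasis->; rewrite map_mx_sum memv_suml // => i _.
  rewrite map_mxZ memvZ // memv_span // map_f //.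
  by rewrite mem_nth ?size_tuple.
have HK_ind (P : 'M[K]_n.+1 -> Prop) :
    linear_pred P -> (forall h, h \in H -> P (map_mx j h)) ->
    forall z, z \in HK -> P z.
  move=> linP PH; apply: span_ind => // _ /mapP[h /vbasis_mem hH ->].
  exact: PH.
have jcomm a b : map_mx j (commr a b) = commr (map_mx j a) (map_mx j b).
  by rewrite /commr map_mxB; congr (_ - _); apply: map_mxM.
have HKHK : lie_closed HK.
  move=> a b aH bH; move: a aH; apply: (HK_ind) => [|a aH].
    split=> [|c u v uH vH]; first by rewrite commrC linear0 oppr0 mem0v.
    by rewrite commr_linearl memvD // memvZ.
  move: b bH; apply: (HK_ind) => [|b bH].
    split=> [|c u v uH vH]; first by rewrite linear0 mem0v.
    by rewrite linearP memvD // memvZ.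
  by rewrite -jcomm jH // -perf mem_commv.
have perfK : (HK <= commv HK HK)%VS.
  apply/subvP; apply: (HK_ind) => [|h].
    by split=> [|c u v uH vH]; rewrite ?mem0v // memvD // memvZ.
  rewrite -{1}perf; move: h; apply: commv_ind => [|a b aH bH].
    split=> [|c u v uH vH]; first by rewrite map_mx0 mem0v.
    by rewrite map_mxD map_mxZ memvD // memvZ.
  by rewrite jcomm mem_commv ?jH.
have isoK : {in HK & HK, forall a b, \tr (a * b) = 0}.
  move=> a b aH bH; move: a aH; apply: (HK_ind) => [|a aH].
    split=> [|c u v uH vH]; first by rewrite mul0r mxtrace0.
    by rewrite mulrDl -scalerAl mxtraceD mxtraceZ uH vH mulr0 addr0.
  move: b bH; apply: (HK_ind) => [|b bH].
    split=> [|c u v uH vH]; first by rewrite mulr0 mxtrace0.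
    by rewrite mulrDr -scalerAr mxtraceD mxtraceZ uH vH mulr0 addr0.
  rewrite (_ : _ * _ = map_mx j (a * b)); last exact/esym/map_mxM.
  by rewrite trace_map_mx iso // rmorph0.
have [k xk] := split_perfect_isotropic_nilpotent charK HKHK perfK isoK split_x (jH x xH).
exists k; apply: (@map_mx_inj _ _ j); rewrite map_mx0 -xk /xK.
by elim: (k) => [|i IH]; rewrite ?expr0 ?map_mx1 // !exprS -IH; apply: map_mxM.
Qed.

(** The derived series becomes stationary for dimension reasons, at a perfect
    [H] contained in [commv g g].  By Engel's theorem [H] has nilpotent
    products, while [H = commv H H] lies in every power of [H]. *)
Theorem cartan_criterion g :
    lie_closed g -> {in commv g g & commv g g, forall a b, \tr (a * b) = 0} ->
  exists k, derv k g = 0%VS.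
Proof.
move=> gg iso.
have closed k : lie_closed (derv k g).
  elim: k => [//|k IH]; apply: (@lie_closed_ideal _ _ (derv k g)).
    exact: commv_sub.
  by move=> a b ak bk; rewrite mem_commv // (subvP (commv_sub IH)).
have desc k : (derv k.+1 g <= derv k g)%VS by apply: commv_sub; apply: closed.
have [k stat] : exists k, derv k.+2 g = derv k.+1 g.
  apply: contrapT => /forallNP noteq.
  have lt_dim k : (\dim (derv k.+2 g) < \dim (derv k.+1 g))%N.
    rewrite ltn_neqAle dimvS // andbT; apply/eqP => E; apply: (noteq k).
    by apply/eqP; rewrite eqEdim desc E leqnn.
  have bound k : (\dim (derv k.+1 g) + k <= \dim (derv 1 g))%N.
    elim: k => [|k IH]; first by rewrite addn0.
    by apply: leq_trans IH; rewrite addnS -addSn leq_add2r.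
  have := bound (\dim (derv 1 g)).+1.
  by rewrite addnS ltnNge leq_addl.
exists k.+1; set H := derv k.+1 g in stat *.
have sH : (H <= commv g g)%VS.
  rewrite /H; elim: (k) => [//|l IH]; exact: subv_trans (desc _) IH.
have [|N HN] := @engel _ _ H (@closed _).
  apply: perfect_isotropic_nilpotent => // a b aH bH.
  by apply: iso; apply: (subvP sH).
have H2 m : (H <= H ^+ m.+1)%VS.
  elim: m => [|m IH]; first by rewrite expv1.
  rewrite -{1}[H]stat; apply: commvP => a b aH bH.
  by rewrite expvSr rpredB // memv_mul // (subvP IH).
apply/eqP; rewrite -subv0 -HN; case: N HN => [|N] HN; last exact: H2.
by rewrite (subv_trans (subvf _)) // -[fullv]prodv1 -(expv0 H) HN prodv0.
Qed.
End CartanCriterion.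

(** * Fitting traces *)

Lemma eq_mx_mulr (F : fieldType) m n (A B : 'M[F]_(m, n)) :
  (forall u : 'rV_m, u *m A = u *m B) -> A = B.
Proof. by move=> AB; apply/row_matrixP => i; rewrite !rowE AB. Qed.

Lemma mulmx_iter (F : fieldType) d (X : 'M[F]_d) (u : 'rV_d) k :
  iter k (mulmxr X) u = u *m X ^+ k.
Proof.
elim: k => [|k IH]; first by rewrite expr0 mulmx1.
by rewrite iterS IH exprSr /= -mulmxA.
Qed.

(** The matrix [P] of [p \o iota] intertwines [X] with the invertible matrix
    [M]; it is onto because [p (iter m T x) = p x *m M ^+ m], where [iter m T x]
    is in the image of [iota].  For a section [Q] of [P], the product
    [X *m P *m Q] has trace [\tr M], and [E = 1 - P *m Q] has its rows in the
    kernel of [P], where [X] is nilpotent. *)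
Lemma fitting_trace_absorbing (F : fieldType) (V : lmodType F)
    (T : {linear V -> V}) (d m : nat) (iota : {linear 'rV[F]_d -> V})
    (X : 'M[F]_d) (t : F) :
    injective iota -> (forall u, iota (u *m X) = T (iota u)) ->
    (forall x, exists u, iota u = iter m T x) ->
  is_fitting_trace T t -> \tr X = t.
Proof.
move=> iota_inj iotaX absorb [n [p [M [p_surj p_ker pT ->]]]].
have iota_iter k u : iota (iter k (mulmxr X) u) = iter k T (iota u).
  by elim: k => //= k IH; rewrite iotaX IH.
have p_iter k x : p (iter k T x) = iter k (mulmxr M) (p x).
  by elim: k => //= k IH; rewrite pT IH.
pose P : 'M_(d, n) := lin1_mx (p \o iota).
have PE u : u *m P = p (iota u) by rewrite mul_rV_lin1.
have XP : X *m P = P *m M.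
  by apply: eq_mx_mulr => u; rewrite !mulmxA !PE iotaX pT.
have Munit : row_free M.
  rewrite -kermx_eq0; apply/eqP/row_matrixP => i; rewrite row0.
  have : row i (kermx M) *m M = 0 by rewrite -row_mul mulmx_ker row0.
  have [x <-] := p_surj (row i (kermx M)); rewrite -pT => /p_ker[k _ Tk].
  by apply/p_ker; exists k.+1 => //; rewrite iterSr.
have M_surj k (v : 'rV_n) : exists v', iter k (mulmxr M) v' = v.
  elim: k => [|k [v' <-]]; first by exists v.
  exists (v' *m invmx M); rewrite iterSr /= mulmxKV //.
  by rewrite -row_free_unit.
have /row_fullP[Q QP] : row_full P.
  rewrite -sub1mx; apply/row_subP => i.
  have [v' <-] := M_surj m (row i 1%:M); have [x <-] := p_surj v'.
  by rewrite -p_iter; have [u <-] := absorb x; rewrite -PE submxMl.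
pose E := 1%:M - P *m Q.
have EP : E *m P = 0 by rewrite mulmxBl mul1mx -mulmxA QP mulmx1 subrr.
have [k EX] : exists k, E *m X ^+ k = 0.
  have rowE i : exists k, row i E *m X ^+ k = 0.
    have : p (iota (row i E)) = 0 by rewrite -PE -row_mul EP row0.
    case/p_ker => k _; rewrite -iota_iter mulmx_iter => E0; exists k.
    by apply: iota_inj; rewrite E0 linear0.
  have [ks ksP] := choice rowE.
  exists (\max_i ks i); apply/row_matrixP => i; rewrite row_mul row0.
  rewrite -(subnKC (leq_bigmax i)) exprD -[_ * _]/(_ *m _).
  by rewrite mulmxA ksP mul0mx.
have EXE : E *m X *m E = E *m X.
  by rewrite mulmxBr mulmx1 -mulmxA (mulmxA X) XP mulmxA mulmxA EP !mul0mx subr0.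
have EXk j : (E *m X) ^+ j.+1 = E *m X ^+ j.+1.
  elim: j => // j IH; rewrite exprS IH -[LHS]/(_ *m _) mulmxA EXE -mulmxA.
  by rewrite [X ^+ j.+2]exprS.
have trEX : \tr (E *m X) = 0.
  apply: (@mxtrace_nilpotent _ _ _ k.+1); rewrite EXk exprSr.
  by rewrite -[_ * _]/(_ *m _) mulmxA EX mul0mx.
have -> : X = X *m P *m Q + X *m E.
  by rewrite -mulmxA mulmxBr mulmx1 addrC subrK.
rewrite mxtraceD [\tr (X *m E)]mxtrace_mulC trEX addr0 XP mxtrace_mulC.
by rewrite mulmxA QP mul1mx.
Qed.

(** * Linear spans and coordinates *)

Section LinearSpan.
Variables (F : fieldType) (V : lmodType F).
Implicit Types S : set V.

Lemma sub_lspan S x : S x -> lspan S x.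
Proof.
by move=> Sx; exists 1%N, (fun=> 1), (fun=> x); rewrite big_ord1 scale1r.
Qed.

Lemma lspan_linear S : linear_pred (lspan S).
Proof.
split=> [|c x y [n [a [v [Sv ->]]]] [m [b [w [Sw ->]]]]].
  by exists 0%N, (fun=> 0), (fun=> 0); rewrite big_ord0; split=> // -[].
exists (n + m)%N,
  (fun i => match split i with inl i => c * a i | inr i => b i end),
  (fun i => match split i with inl i => v i | inr i => w i end).
split=> [i|]; first by case: (split i).
rewrite big_split_ord scaler_sumr; congr (_ + _); apply: eq_bigr => i _.
  by rewrite -[lshift m i]/(unsplit (inl i)) unsplitK scalerA.
by rewrite -[rshift n i]/(unsplit (inr i)) unsplitK.
Qed.

Lemma lspan_ind (P : V -> Prop) S :
  linear_pred P -> (forall x, S x -> P x) -> forall x, lspan S x -> P x.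
Proof.
move=> linP SP x [n [c [v [Sv ->]]]]; apply: linear_pred_sum => // i _.
exact: SP.
Qed.

(** A spanning family gives a surjection from row vectors; its restriction to
    a complement of the kernel is bijective. *)
Lemma finite_dimensional_coordinates (A : set V) : finite_dimensional A ->
  exists n (iota : {linear 'rV[F]_n -> V}),
    injective iota /\ forall x, A x <-> exists u, iota u = x.
Proof.
case=> s ->.
pose f (u : 'rV[F]_(size s)) : V := \sum_i u 0 i *: s`_i.
have f_lin : linear f.
  move=> c u v; rewrite /f scaler_sumr -big_split; apply: eq_bigr => i _ /=.
  by rewrite !mxE scalerA scalerDl.
pose fM := GRing.isLinear.Build F _ V *:%R f f_lin.
pose fL : {linear 'rV[F]_(size s) -> V} := HB.pack f fM.
have [N NP] : exists N : {vspace 'rV[F]_(size s)}, forall u, u \in N <-> fL u = 0.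
  apply: vspace_of_pred; split; first exact: linear0.
  by move=> c u v fu fv; rewrite linearP fu fv scaler0 addr0.
pose W := (N^C)%VS.
pose g (w : 'rV[F]_(\dim W)) := \sum_i w 0 i *: (vbasis W)`_i.
have g_lin : linear g.
  move=> c u v; rewrite /g scaler_sumr -big_split; apply: eq_bigr => i _ /=.
  by rewrite !mxE scalerA scalerDl.
pose gM := GRing.isLinear.Build F _ _ *:%R g g_lin.
pose gL : {linear 'rV[F]_(\dim W) -> 'rV[F]_(size s)} := HB.pack g gM.
have gW w : gL w \in W.
  by apply: memv_suml => i _; rewrite memvZ // vbasis_mem // mem_nth ?size_tuple.
exists (\dim W), (fL \o gL); split=> [|x].
  apply: raddf_inj => w /= /NP gN.
  have : gL w \in (N :&: W)%VS by rewrite memv_cap gN gW.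
  rewrite capv_compl memv0 => /eqP g0; apply/rowP => i; rewrite mxE.
  by move/freeP: (basis_free (vbasisP W)) => /(_ (fun i => w 0 i) g0 i).
split=> [|[w <-]]; last first.
  apply: linear_pred_sum; first exact: lspan_linear.
  by move=> i _; apply: sub_lspan; rewrite /= mem_nth.
have fsurj : lspan [set` s] x -> exists u, fL u = x.
  move: x; apply: lspan_ind => [|x /= xs].
    split=> [|c x y [u <-] [v <-]]; first by exists 0; rewrite linear0.
    by exists (c *: u + v); rewrite linearP.
  have lt_i : (index x s < size s)%N by rewrite index_mem.
  exists (delta_mx 0 (Ordinal lt_i)); rewrite /= /f (bigD1 (Ordinal lt_i)) //=.
  rewrite mxE !eqxx scale1r nth_index // big1 ?addr0 // => j ji.
  by rewrite mxE (negPf ji) andbF scale0r.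
case/fsurj => u <-; have : u \in (N + W)%VS by rewrite addv_complf memvf.
case/memv_addP => k /NP fk [w wW ->].
exists (\row_i coord (vbasis W) i w); rewrite linearD fk add0r /=.
congr (fL _); rewrite [RHS](coord_vbasis wW).
by apply: eq_bigr => i _; rewrite mxE.
Qed.
End LinearSpan.

(** * Lie algebras and their adjoint matrices *)

Section LieAlgebra.
Variables (F : fieldType) (L : lieAlgType F).
Implicit Types (a b x y : L) (A B : set L).

HB.instance Definition _ a :=
  GRing.isLinear.Build F L L *:%R (bracket a)
    (fun c x y => bracket_linear_r c x y a).

Lemma bracketC x y : bracket x y = - bracket y x.
Proof.
have := bracketxx (x + y); rewrite linearD /=.
rewrite -!/(ad _ (x + y)) !linearD /= /ad !bracketxx add0r addr0 => /eqP.
by rewrite addr_eq0 => /eqP ->; rewrite opprK.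
Qed.

(** The Jacobi identity for right multiplications, the form in which the
    adjoint action on row vectors is a morphism to matrix commutators. *)
Lemma bracket_bracketr x a b :
  bracket x (bracket a b) = bracket (bracket x a) b - bracket (bracket x b) a.
Proof.
have := bracket_jacobi x a b; rewrite [bracket (bracket a b) x]bracketC.
rewrite [bracket (bracket b x) a](_ : _ = - bracket (bracket x b) a); last first.
  by rewrite [bracket b x]bracketC -/(ad a _) linearN.
by move=> /eqP; rewrite addrAC subr_eq0 => /eqP ->.
Qed.

Definition derived_set k A : set L := iter k (fun B => bracket_set B B) A.

Lemma mem_bracket_set A B x y : A x -> B y -> bracket_set A B (bracket x y).
Proof. by move=> Ax By; apply: sub_lspan; exists x, y. Qed.

Lemma bracket_set_ind (P : L -> Prop) A B :
    linear_pred P -> (forall x y, A x -> B y -> P (bracket x y)) ->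
  forall x, bracket_set A B x -> P x.
Proof. by move=> linP PAB; apply: lspan_ind => // _ [x [y [Ax By ->]]]; apply: PAB. Qed.

Lemma bracket_setS A A' B B' :
  A `<=` A' -> B `<=` B' -> bracket_set A B `<=` bracket_set A' B'.
Proof.
move=> sA sB; apply: bracket_set_ind; first exact: lspan_linear.
by move=> x y Ax By; apply: mem_bracket_set; [apply: sA|apply: sB].
Qed.

Lemma derived_setS k A B : A `<=` B -> derived_set k A `<=` derived_set k B.
Proof. by move=> sAB; elim: k => //= k IH; apply: bracket_setS. Qed.

Lemma subalgebra_linear A : subalgebra A -> linear_pred A.
Proof. by move=> [A0 AD AZ _]; split=> // c x y Ax Ay; apply: AD => //; apply: AZ. Qed.

Lemma derived_set_linear k A : subalgebra A -> linear_pred (derived_set k A).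
Proof.
case: k => [|k] subA; first exact: subalgebra_linear.
exact: lspan_linear.
Qed.

Lemma derived_set_sub k A : subalgebra A -> derived_set k A `<=` A.
Proof.
move=> subA; elim: k => //= k IH; apply: bracket_set_ind.
  exact: subalgebra_linear.
by case: subA => _ _ _ AA x y Dx Dy; apply: AA; apply: IH.
Qed.

Lemma solvable_sub A B :
  subalgebra A -> A `<=` B -> solvable_alg B -> solvable_alg A.
Proof.
move=> subA sAB [k Bk]; exists k; apply/seteqP; split=> x.
  by move=> /(@derived_setS k _ _ sAB); rewrite /derived_set Bk.
by move=> ->; case: (derived_set_linear k subA).
Qed.

Lemma finite_dimensional_sub_locally_solvable A :
    locally_solvable L -> subalgebra A -> finite_dimensional A ->
  solvable_alg A.
Proof.
move=> lsL subA [s As]; have [B [subB solB sB]] := lsL s.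
apply: (solvable_sub subA _ solB); rewrite As; apply: lspan_ind => //.
exact: subalgebra_linear.
Qed.

Lemma derived_algebra_finite a : derived_algebra L a ->
  exists s : seq L, forall A, [set` s] `<=` A -> derived_set 1 A a.
Proof.
move: a; apply: bracket_set_ind => [|x y _ _].
  split; first by exists [::] => A _; exact: (proj1 (lspan_linear _)).
  move=> c x y [s sP] [t tP]; exists (s ++ t) => A stA.
  apply: (lspan_linear _).2; [apply: sP|apply: tP] => z /= zs;
    by apply: stA; rewrite /= mem_cat zs ?orbT.
exists [:: x; y] => A xyA; apply: mem_bracket_set; apply: xyA => /=.
  exact: mem_head.
by rewrite !inE eqxx orbT.
Qed.

Lemma iter_ad_mem A n a x : A a -> L_adn A n `<=` A -> A (iter n (ad a) x).
Proof.
move=> Aa; apply; apply: sub_lspan; exists x, [tuple of nseq n a]; split=> [i|].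
  by rewrite tnth_nseq.
by rewrite /=; elim: n x => //= n IH x; rewrite -IH -iterSr.
Qed.

Lemma iter_comp2 (T : Type) (f : T -> T) m z :
  iter m (f \o f) z = iter (m + m) f z.
Proof. by elim: m => // m IH; rewrite iterS IH addnS addSn !iterS. Qed.

(** The Fitting null component is the whole space, so the induced
    transformation lives in dimension 0. *)
Lemma fitting_trace_nilpotent a k :
  (forall x, iter k (ad a) x = 0) -> is_fitting_trace (ad a \o ad a) 0.
Proof.
move=> ak.
exists 0%N, (\0 : {linear L -> 'rV[F]_0}), 0; split.
- by move=> u; exists 0; rewrite linear0 [u]thinmx0.
- move=> x; split=> // _; exists k.+1 => //.
  by rewrite (iter_comp2 (ad a)) iterD iterSr ak.
- by move=> x; rewrite [LHS]thinmx0 [RHS]thinmx0.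
- by rewrite mxtrace0.
Qed.

Section Adjoint.
Variables (A : set L) (n : nat) (iota : {linear 'rV[F]_n -> L}).
Hypotheses (subA : subalgebra A) (iota_inj : injective iota).
Hypothesis iotaA : forall x, A x <-> exists u, iota u = x.

Lemma adjoint_matrix :
  exists M : L -> 'M[F]_n, forall a u, A a -> iota (u *m M a) = bracket (iota u) a.
Proof.
have Aiota u : A (iota u) by apply/iotaA; exists u.
have c_ex x : exists u, A x -> iota u = x.
  case: (pselect (A x)) => [/iotaA[u <-]|nA]; first by exists u.
  by exists 0.
have [c cP] := choice c_ex.
exists (fun a => \matrix_i c (bracket (iota (delta_mx 0 i)) a)) => a u Aa.
rewrite mulmx_sum_row linear_sum [in RHS](row_sum_delta u) linear_sum -/(ad a _) linear_sum.
apply: eq_bigr => i _; rewrite !linearZ /= rowK cP //.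
by case: subA => _ _ _; apply.
Qed.

Variable M : L -> 'M[F]_n.
Hypothesis ME : forall a u, A a -> iota (u *m M a) = bracket (iota u) a.

Lemma adjoint_linear c a b :
  A a -> A b -> M (c *: a + b) = c *: M a + M b.
Proof.
move=> Aa Ab; apply: eq_mx_mulr => u; apply: iota_inj.
have Aab : A (c *: a + b) by apply: (subalgebra_linear subA).2.
by rewrite mulmxDr -scalemxAr linearP !ME // linearP.
Qed.

Lemma adjoint_bracket a b : A a -> A b ->
  M (bracket a b) = M a *m M b - M b *m M a.
Proof.
move=> Aa Ab; apply: eq_mx_mulr => u; apply: iota_inj.
have Aab : A (bracket a b) by case: subA => _ _ _; apply.
by rewrite mulmxBr linearB !mulmxA !ME // bracket_bracketr.
Qed.

Lemma adjoint0 : M 0 = 0.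
Proof.
have [A0 _] := subalgebra_linear subA.
have := adjoint_linear 0 A0 A0; rewrite !scale0r !add0r.
by have := adjoint_linear (-1) A0 A0; rewrite scaler0 addr0 scaleN1r addNr.
Qed.

Lemma iter_adjoint k a u : A a ->
  iota (iter k (mulmxr (M a)) u) = iter k (ad a) (iota u).
Proof. by move=> Aa; elim: k => //= k IH; rewrite ME // IH. Qed.

End Adjoint.
End LieAlgebra.

(** * Solvability of a finite-dimensional subalgebra *)

Section AdjointAlgebra.
Variables (F : fieldType) (L : lieAlgType F) (A : set L) (n : nat).
Variable iota : {linear 'rV[F]_n.+1 -> L}.
Hypotheses (charF : [pchar F] =i pred0).
Hypotheses (subA : subalgebra A) (iota_inj : injective iota).
Hypothesis iotaA : forall x, A x <-> exists u, iota u = x.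
Variable M : L -> 'M[F]_n.+1.
Hypothesis ME : forall a u, A a -> iota (u *m M a) = bracket (iota u) a.

(** The matrices [M a] for [a] in [A] form a Lie algebra, and [M] maps the
    derived series of [A] onto the derived series of that algebra. *)
Lemma adjoint_algebra : exists2 g : {vspace 'M[F]_n.+1},
  lie_closed g & forall k m, m \in derv k g <-> exists2 a, derived_set k A a & M a = m.
Proof.
have linM k : linear_pred (fun m => exists2 a, derived_set k A a & M a = m).
  have linD := derived_set_linear k subA.
  split; first by exists 0; [case: linD|apply: adjoint0 ME].
  move=> c _ _ [a Da <-] [b Db <-]; exists (c *: a + b); first exact: linD.2.
  by rewrite (adjoint_linear subA iota_inj ME) //; apply: (derived_set_sub (k := k)).
have [g gP] := vspace_of_pred (linM 0%N).
suff img k m : m \in derv k g <-> exists2 a, derived_set k A a & M a = m.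
  exists g => // x y xg yg.
  have /(img 1%N)[b Db <-] : commr x y \in derv 1 g by apply: mem_commv.
  by apply/(img 0%N); exists b => //; apply: (derived_set_sub (k := 1)).
elim: k m => [|k IH] m; first exact: gP.
have brM a b : derived_set k A a -> derived_set k A b ->
    M (bracket a b) = commr (M a) (M b).
  by move=> Da Db; rewrite (adjoint_bracket subA iota_inj ME) //;
     apply: (derived_set_sub (k := k)).
split=> [|[a Da <-]].
  move: m; apply: commv_ind => [|_ _ /IH[a Da <-] /IH[b Db <-]]; first exact: linM.
  by exists (bracket a b); [apply: mem_bracket_set|apply: brM].
suff [] : A a /\ M a \in derv k.+1 g by [].
move: a Da; apply: bracket_set_ind => [|a b Da Db].
  split; first by rewrite (adjoint0 subA iota_inj ME) mem0v; case: (subalgebra_linear subA).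
  move=> c x y [Ax Mx] [Ay My]; split; first by apply: (subalgebra_linear subA).2.
  by rewrite (adjoint_linear subA iota_inj ME) // memvD // memvZ.
have [Aa Ab] := (derived_set_sub subA Da, derived_set_sub subA Db).
split; first by case: subA => _ _ _; apply.
by rewrite brM // mem_commv // IH; [exists a|exists b].
Qed.

(** The adjoint matrices of a solvable [A] form a solvable matrix algebra, and
    [M a] lies in its derived algebra. *)
Lemma solvable_adjoint_nilpotent : solvable_alg A ->
  forall a, derived_set 1 A a -> exists k, forall x, A x -> iter k (ad a) x = 0.
Proof.
move=> [k Ak] a Da; have [g gg gP] := adjoint_algebra.
have gk : derv k g = 0%VS.
  apply/eqP; rewrite -subv0; apply/subvP => m /gP[b].
  rewrite /derived_set Ak => -> <-.
  by rewrite (adjoint0 subA iota_inj ME) mem0v.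
have [N gN] := solvable_derived_nilpotent charF gg gk.
have Ma : M a \in commv g g by apply/(gP 1%N); exists a.
exists N => x /iotaA[u <-].
have Aa : A a by apply: (derived_set_sub (k := 1)).
rewrite -(iter_adjoint ME) // mulmx_iter.
suff -> : M a ^+ N = 0 by rewrite mulmx0 linear0.
apply/eqP; rewrite -memv0 -gN.
elim: N {gN} => [|N IH]; first by rewrite expv0 expr0 memv_line.
by rewrite exprSr expvSr memv_mul.
Qed.

(** Cartan's criterion makes some term [D] of the derived series of [A] act by
    zero on [A]; then [D] is abelian and the next term vanishes. *)
Lemma isotropic_solvable :
  (forall a, derived_set 1 A a -> \tr (M a *m M a) = 0) -> solvable_alg A.
Proof.
move=> tr0; have [g gg gP] := adjoint_algebra.
have sq0 x : x \in commv g g -> \tr (x * x) = 0.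
  by move=> /(gP 1%N)[a Da <-]; apply: tr0.
have iso : {in commv g g & commv g g, forall x y, \tr (x * y) = 0}.
  move=> x y xg yg; have := sq0 (x + y) (memvD xg yg).
  rewrite mulrDl !mulrDr !mxtraceD !sq0 // add0r addr0.
  rewrite [\tr (y * x)]mxtrace_mulC -[\tr (x *m y)]/(\tr (x * y)) -mulr2n.
  by move/eqP; rewrite -mulr_natr mulf_eq0 (pcharf0P _).1 // orbF => /eqP.
have [k gk] := cartan_criterion charF gg iso.
(* One step further than g, because of the center of A. *)
exists k.+1; rewrite -[LHS]/(derived_set k.+1 A); apply/seteqP; split=> x; last first.
  by move=> ->; case: (derived_set_linear k.+1 subA).
move: x; apply: bracket_set_ind => [|a b Da Db].
  by split=> // c x y -> ->; rewrite scaler0 addr0.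
have [Aa Ab] := (derived_set_sub subA Da, derived_set_sub subA Db).
have /iotaA[u <-] := Aa; rewrite /= -ME //.
have : M b \in derv k g by apply/gP; exists b.
by rewrite gk memv0 => /eqP ->; rewrite mulmx0 linear0.
Qed.

End AdjointAlgebra.

Theorem mainTheorem3 (F : fieldType) (L : lieAlgType F)
    (charF : [pchar F] =i pred0)
    (locfinL : locally_finite L)
    (hL : forall s : seq L, exists A : set L,
        [/\ subalgebra A, finite_dimensional A, [set` s] `<=` A
          & exists2 n : nat, (0 < n)%N & L_adn A n `<=` A]) :
  locally_solvable L <->
  (forall a : L, derived_algebra L a -> is_fitting_trace (ad a \o ad a) 0).
Proof.
split=> [lsL a /derived_algebra_finite[s sP]|traceL s].
  have [A [subA fdA sA [m _ mA]]] := hL s.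
  have Da := sP A sA.
  have solA := finite_dimensional_sub_locally_solvable lsL subA fdA.
  have Aa : A a by apply: (derived_set_sub (k := 1)).
  suff [k Ak] : exists k, forall x, A x -> iter k (ad a) x = 0.
    apply: (@fitting_trace_nilpotent _ _ _ (k + m)) => x.
    by rewrite iterD Ak //; apply: iter_ad_mem.
  (* Square matrices form a unital algebra with 1 != 0 only in positive size, so
     A = 0 is treated apart. *)
  have [[|n] [iota [iota_inj iotaA]]] := finite_dimensional_coordinates fdA.
    exists 0%N => x /iotaA[u <-]; by rewrite [u]thinmx0 linear0.
  have [M ME] := adjoint_matrix subA iotaA.
  exact: (solvable_adjoint_nilpotent charF subA iota_inj iotaA ME solA).
have [A [subA fdA sA [m _ mA]]] := hL s.
exists A; split=> //.
have [[|n] [iota [iota_inj iotaA]]] := finite_dimensional_coordinates fdA.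
  exists 0%N; apply/seteqP; split=> x; last first.
    by move=> ->; case: (subalgebra_linear subA).
  by move=> /iotaA[u <-]; rewrite [u]thinmx0 linear0.
have [M ME] := adjoint_matrix subA iotaA.
apply: (isotropic_solvable charF subA iota_inj iotaA ME) => a Da.
have Aa : A a by apply: (derived_set_sub (k := 1)).
have La : derived_algebra L a by move: Da; apply: bracket_setS.
apply: (fitting_trace_absorbing (m := m) iota_inj _ _ (traceL a La)) => [u|x].
  by rewrite mulmxA !ME.
by apply/iotaA; rewrite /= (iter_comp2 (ad a)) iterD; apply: iter_ad_mem.
Qed.
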